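(* Let $M\ge 1$, $N\ge 2$, let $k_1,\dots,k_M>0$ be wave numbers, let $x_1,\dots,x_N$ be the imaging pixels with total path lengths $L_1,\dots,L_N$, and let $A=(e^{-jk_iL_n})_{1\le i\le M,\,1\le n\le N}$ be the sensing matrix. Assume that two point targets are located at arbitrary pixels $x_p$ and $x_q$ ($p\neq q$) of the imaging area, i.e. the exact solution $X^o\in\mathbb{C}^N$ has $p$-th and $q$-th entries equal to $1$ and all other entries equal to $0$. Let $b=AX^o$ and $\tilde X=A^*b$. Then the magnitude $|\tilde X_p|=|\tilde X_q|$ of the two reconstructed point targets is the maximum, i.e. equal to $2M$, if and only if $k_i(L_p-L_q)$ is an integer multiple of $2\pi$ for every $i=1,2,\dots,M$.
   Context: Setting: a noiseless linear imaging system $AX=b$ with a single transmitter $T_x$, a single receiver $R_x$, and $M$ frequencies with wave numbers $k_1,\dots,k_M>0$. The imaging area has $N$ pixels located at points $x_1,\dots,x_N$ of Euclidean space, and $L_n=|T_x-x_n|+|x_n-R_x|$ is the total path length from the transmitter to $x_n$ and then to the receiver. Here $j$ is the imaginary unit. The sensing matrix $A$ is the $M\times N$ complex matrix with $(i,n)$ entry $e^{-jk_iL_n}$, and $A^*$ is its conjugate transpose. The data are generated synthetically (''inverse crime'') by $b=AX^o$, where $X^o\in\mathbb{C}^N$ is the exact reflectivity vector (interference between the targets is neglected), and the reconstructed solution is $\tilde X=A^*b$. The reconstructed values of the point targets at pixels $x_p,x_q$ are the entries $\tilde X_p,\tilde X_q$; they always have equal magnitude. ''Maximum'' refers to the largest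 potential value of this magnitude, which is $2M$. *)

(* Defs.v *)
From HB Require Import structures.
From mathcomp Require Import all_boot all_order all_algebra.
From mathcomp Require Import spectral complex.
From mathcomp Require Import reals sequences exp trigo.

Set Implicit Arguments.
Unset Strict Implicit.
Unset Printing Implicit Defensive.

Import Order.TTheory GRing.Theory Num.Theory.

Local Open Scope ring_scope.
Local Open Scope complex_scope.
Local Open Scope sesquilinear_scope.

(* The canonical norm on matrices is the sup norm, hence this definition. *)
Definition euclidean_norm (R : realType) (d : nat) (u : 'rV[R]_d) : R :=
  Num.sqrt (\sum_(i < d) u 0 i ^+ 2).

(* The complex exponential e^z = e^(Re z) (cos (Im z) + j sin (Im z)). *)
Definition cexp (R : realType) (z : R[i]) : R[i] :=
  (expR (complex.Re z))%:C * (cos (complex.Im z) +i* sin (complex.Im z)).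

Definition path_length (R : realType) (d : nat) (Tx Rx x : 'rV[R]_d) : R :=
  euclidean_norm (Tx - x) + euclidean_norm (x - Rx).

Definition sensing_matrix (R : realType) (M N : nat)
    (k : 'I_M -> R) (L : 'I_N -> R) : 'M[R[i]]_(M, N) :=
  \matrix_(i < M, n < N) cexp (- ('i%C * (k i * L n)%:C)).

(* Main.v *)
(* Writing t_i = k_i (L_p - L_q), one finds X_p = sum_i (1 + exp(j t_i)), and X_q is its conjugate. Each summand has modulus at most 2, so |X_p| <= 2M, and equality forces |1 + exp(j t_i)| = 2, that is exp(j t_i) = 1, for every i. *)
Require Import Defs.
From HB Require Import structures.
From mathcomp Require Import all_boot all_order all_algebra.
From mathcomp Require Import spectral complex.
From mathcomp Require Import reals sequences exp trigo.

Import Order.TTheory GRing.Theory Num.Theory.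

Local Open Scope ring_scope.
Local Open Scope complex_scope.
Local Open Scope sesquilinear_scope.

(** For the direct implication, [t] is reduced modulo [2 * pi] and the half-angle [r] of the
    remainder satisfies [sin r = 0], which forces [r = 0]. *)
Lemma cos_eq1 (R : realType) (t : R) :
  cos t = 1 <-> exists z : int, t = z%:~R * (2 * pi).
Proof.
have pi2_gt0 : 0 < 2 * pi :> R by rewrite mulr_gt0 ?pi_gt0.
have cosDz (z : int) (a : R) : cos (a + z%:~R * (2 * pi)) = cos a.
  have cosDn (n : nat) (c : R) : cos (c + n%:R * (2 * pi)) = cos c.
    by rewrite !mulr_natl (periodicn (@cosD2pi R)).
  case: z => n; first exact: cosDn.
  (* A negative shift is undone by adding the opposite natural multiple of the period. *)
  by rewrite NegzE mulrNz mulNr -[LHS](cosDn n.+1) subrK.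
split=> [cost1|[z ->]]; last by rewrite -[_ * _]add0r cosDz cos0.
exists (Num.floor (t / (2 * pi))); set z := Num.floor _.
(* Halving brings the remainder from [[0, 2 * pi)] into [[0, pi)], where [sin] vanishes only at
   0. *)
pose r := (t - z%:~R * (2 * pi)) / 2.
have tE : t = r *+ 2 + z%:~R * (2 * pi) by rewrite mulr2n -splitr subrK.
have /andP[z_le z_gt] := floor_itv (t / (2 * pi)).
have r_ge0 : 0 <= r by rewrite divr_ge0 // subr_ge0 -ler_pdivlMr.
have r_ltpi : r < pi.
  rewrite ltr_pdivrMr // ltrBlDr [pi * 2]mulrC -[X in X + _]mul1r -mulrDl.
  by rewrite addrC -ltr_pdivrMr // -(intrD _ z 1).
have sinr0 : sin r = 0.
  (* The goal becomes [cos r ^+ 2 = 1]. Doubling and subtracting 1, both injective, turn it into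
     [cos (r *+ 2) = 1], which is [cos t = 1] up to periods. *)
  apply/eqP; rewrite -sqrf_eq0 sin2cos2 subr_eq0 eq_sym.
  rewrite -(inj_eq (@pmulrnI R 2 isT)) -(inj_eq (addIr (-1))).
  by rewrite -cos_mulr2n -(cosDz z) -tE cost1 mulr2n addrK.
suff r0 : r = 0 by rewrite tE r0 mul0rn add0r.
apply: contra_eq sinr0 => r_neq0.
have r_gt0 : 0 < r by rewrite lt0r r_neq0.
by rewrite gt_eqF // sin_gt0_pi // r_gt0.
Qed.

(** Equality in the triangle inequality makes 1 and [e] nonnegative multiples of one unit [u]; both
    having modulus 1, both equal [u]. *)
Lemma eq1_norm_add1 (C : numClosedFieldType) (e : C) :
  `|e| = 1 -> `|1 + e| = 2 -> e = 1.
Proof.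
move=> e1 he; have := @normCDeq C 1 e.
rewrite normr1 e1 he => /(_ erefl)[u _ ]; rewrite !mul1r.
by move=> [<- ->].
Qed.

(** The [?= iff] form packages the upper bound together with its equality case; the theorem needs
    both. *)
Lemma norm_sum_add1 (C : numClosedFieldType) (I : finType) (e : I -> C)
    (e1 : forall i, `|e i| = 1) :
  `|\sum_i (1 + e i)| <= (2 * #|I|)%:R ?= iff [forall i, e i == 1].
Proof.
have le2 i : `|1 + e i| <= 2.
  by rewrite (le_trans (ler_normD _ _)) // normr1 e1.
have sum2 : \sum_(i : I) 2 = (2 * #|I|)%:R :> C.
  by rewrite sumr_const natrM mulr_natr.
have le_sum : `|\sum_i (1 + e i)| <= (2 * #|I|)%:R.
  rewrite (le_trans (ler_norm_sum _ _ _)) // -sum2.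
  by apply: ler_sum => i _.
split=> //; apply/eqP/forallP => [eq2 i|e_eq1]; last first.
  rewrite (eq_bigr (fun=> 2)) => [|i _]; first by rewrite sum2 normr_nat.
  by rewrite (eqP (e_eq1 i)).
apply/eqP/eq1_norm_add1 => //.
(* Terms bounded by 2 whose sum equals the sum of the bounds must each attain 2. The sum of the
   moduli is squeezed between [|\sum_i (1 + e i)|] and [2 * #|I|], equal by [eq2]. *)
apply: (@normC_sum_upper C I xpredT (fun i => `|1 + e i|) (fun=> 2)) => //.
  by move=> j _; rewrite normr_id.
apply/eqP; rewrite eq_le ler_sum //= sum2 -eq2; exact: ler_norm_sum.
Qed.

Definition cis {R : realType} (t : R) : R[i] := cos t +i* sin t.

Lemma cexpNi (R : realType) (t : R) : cexp (- ('i%C * t%:C)) = cis (- t).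
Proof.
rewrite /cexp /cis /= !mul0r !mul1r subrr oppr0 add0r expR0.
exact: mul1r.
Qed.

Lemma norm_cis (R : realType) (t : R) : `|cis t| = 1.
Proof. by rewrite normc_def /= cos2Dsin2 sqrtr1. Qed.

Lemma conj_cis (R : realType) (t : R) : (cis t)^*%C = cis (- t).
Proof. by rewrite /cis cosN sinN. Qed.

Lemma cisD (R : realType) (s t : R) : cis (s + t) = cis s * cis t.
Proof. by rewrite /cis cosD sinD [sin s * _ + _]addrC. Qed.

Lemma cis_eq1 (R : realType) (t : R) : cis t = 1 <-> exists z : int, t = z%:~R * (2 * pi).
Proof.
rewrite -cos_eq1; split=> [[]|cost1] //.
by rewrite /cis cost1 cos1sin0 // cost1 normr1.
Qed.

Theorem theorem3 (R : realType) (d M N : nat)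
    (hM : (1 <= M)%N) (hN : (2 <= N)%N)
    (k : 'I_M -> R) (hk : forall i, 0 < k i)
    (Tx Rx : 'rV[R]_d) (x : 'I_N -> 'rV[R]_d)
    (L : 'I_N -> R) (hL : forall n, L n = path_length Tx Rx (x n))
    (A : 'M[R[i]]_(M, N)) (hA : A = sensing_matrix k L)
    (p q : 'I_N) (hpq : p != q)
    (Xo : 'cV[R[i]]_N) (hXp : Xo p 0 = 1) (hXq : Xo q 0 = 1)
    (hX0 : forall n, n != p -> n != q -> Xo n 0 = 0)
    (b : 'cV[R[i]]_M) (hb : b = A *m Xo)
    (X : 'cV[R[i]]_N) (hX : X = A ^t* *m b) :
  [/\ `|X p 0| = `|X q 0|,
      `|X p 0| <= (2 * M)%:R
    & `|X p 0| = (2 * M)%:R <->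
      forall i, exists z : int, k i * (L p - L q) = z%:~R * (2 * pi) ].
Proof.
(* Stated for a generic pair so that it applies to both [(p, q)] and [(q, p)]. *)
have XE (u v : 'I_N) : u != v -> Xo u 0 = 1 -> Xo v 0 = 1 ->
    (forall n, n != u -> n != v -> Xo n 0 = 0) ->
    X u 0 = \sum_i (1 + cis (k i * (L u - L v))).
  move=> uv Xu Xv X0; rewrite hX mxE; apply: eq_bigr => i _.
  rewrite hb [X in _ * X]mxE (bigD1 u) //= (bigD1 v) 1?eq_sym //= big1 ?addr0; last first.
    by move=> n /andP[nu nv]; rewrite X0 // mulr0.
  (* In the product with the conjugate of the [(i, u)] entry, target [u] contributes [cis 0 = 1] and
     target [v] the phase difference. *)
  rewrite Xu Xv !mulr1 hA !mxE !cexpNi mulrDr.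
  have -> (z : R[i]) : Num.conj z = z^*%C by [].
  by rewrite conj_cis -!cisD opprK subrr mulrBr /cis cos0 sin0.
have Xp := XE p q hpq hXp hXq hX0.
have Xq : X q 0 = (X p 0)^*%C.
  rewrite Xp (XE q p) 1?eq_sym // => [|n nq np]; last exact: hX0.
  rewrite rmorph_sum; apply: eq_bigr => i _.
  (* Swapping [p] and [q] negates the phase, which is conjugation. *)
  rewrite rmorphD rmorph1; congr (1 + _).
  by rewrite [RHS]conj_cis -mulrN opprB.
have := @norm_sum_add1 _ _ (fun i => cis (k i * (L p - L q)))
  (fun i => norm_cis R _).
rewrite -Xp card_ord => leX; split; first by rewrite Xq normcJ.
  exact: leX.
split=> [/eqP|kL].
  by rewrite leX => /forallP h i; apply/cis_eq1/eqP/h.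
by apply/eqP; rewrite leX; apply/forallP => i; apply/eqP/cis_eq1/kL.
Qed.
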